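(* Let $m\ge 2$ be an integer. If there is an $(m-1)$-satisfactory coloring of $\mathbb Z^+$, then Graham's conjecture holds for $n=m$; that is, for all integers $0<a_1<a_2<\cdots<a_m$ one has $$\max_{1\le i,j\le m}\frac{a_i}{\gcd(a_i,a_j)}\ge m.$$
   Context: For a positive integer $n$, an $n$-satisfactory coloring of $\mathbb Z^+$ (the positive integers) is a coloring of $\mathbb Z^+$ using exactly $n$ colors such that for every positive integer $a$ the numbers $a,2a,\dots,na$ all receive different colors. *)

(* Defs.v *)
From mathcomp Require Import all_boot.

Set Implicit Arguments.
Unset Strict Implicit.
Unset Printing Implicit Defensive.

(* A coloring of the positive integers with n colors is the restriction to
   positive arguments of a function nat -> 'I_n; the value at 0 is ignored. *)
Definition satisfactory (n : nat) (c : nat -> 'I_n) : Prop :=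
  (forall k : 'I_n, exists2 x : nat, 0 < x & c x = k) /\
  (forall a : nat, 0 < a ->
     forall r s : nat, 1 <= r <= n -> 1 <= s <= n ->
       r <> s -> c (r * a) <> c (s * a)).

(* The quotient %/ is exact here, since gcdn (a i) (a j) divides a i. *)
Definition graham_conjecture_for (n : nat) : Prop :=
  forall a : 'I_n -> nat,
    (forall i : 'I_n, 0 < a i) ->
    (forall i j : 'I_n, i < j -> a i < a j) ->
    n <= \max_(i < n) \max_(j < n) (a i %/ gcdn (a i) (a j)).

(* Main.v *)
Require Import Defs.
From mathcomp Require Import all_boot.

(** Colour the [m] numbers with [m - 1] colours: two of them, [x <> y], share
    a colour.  With [d = gcdn x y] they are the multiples [(x %/ d) * d] and
    [(y %/ d) * d] of the same [d], with different multipliers.  A satisfactory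
    coloring separates distinct multipliers up to [m - 1], so one of
    the two multipliers is at least [m], and both occur in the maximum. *)

(** If both reduced quotients were at most [n], then [x] and [y] would be
    distinct entries of the list [d, 2d, ..., nd] for [d = gcdn x y]. *)
Lemma satisfactory_same_color_quotient n (c : nat -> 'I_n) x y :
  satisfactory c -> 0 < x -> 0 < y -> x != y -> c x = c y ->
  (n < x %/ gcdn x y) || (n < y %/ gcdn y x).
Proof.
move=> [_ sepc] x0 y0 neq_xy cxy; rewrite (gcdnC y x).
have d0 : 0 < gcdn x y by rewrite gcdn_gt0 x0.
have xE := divnK (dvdn_gcdl x y); have yE := divnK (dvdn_gcdr x y).
have qx0 : 0 < x %/ gcdn x y by rewrite divn_gt0 // dvdn_leq ?dvdn_gcdl.
have qy0 : 0 < y %/ gcdn x y by rewrite divn_gt0 // dvdn_leq ?dvdn_gcdr.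
case: leqP => //= qx; case: leqP => //= qy.
have := sepc _ d0 (x %/ gcdn x y) (y %/ gcdn x y).
rewrite qx0 qy0 qx qy xE yE => /(_ isT isT) sep_xy; case: (sep_xy _ cxy) => qE.
by case/eqP: neq_xy; rewrite -[LHS]xE -[RHS]yE qE.
Qed.

Theorem theorem1p4 (m : nat) (hm : 2 <= m)
  (hc : exists c : nat -> 'I_(m - 1), satisfactory c) :
  graham_conjecture_for m.
Proof.
case: hc => c satc a a0 a_incr.
have quot_le i j :
    a i %/ gcdn (a i) (a j) <=
      \max_(i < m) \max_(j < m) (a i %/ gcdn (a i) (a j)).
  apply: leq_trans (leq_bigmax i).
  exact: (leq_bigmax (F := fun j => a i %/ gcdn (a i) (a j))).
have [i [j [lt_ij cij]]] : exists i j : 'I_m, i < j /\ c (a i) = c (a j).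
  have /injectivePn[i [j neq_ij cij]] : ~~ injectiveb (fun i => c (a i)).
    apply/negP => /injectiveP /leq_card.
    by rewrite !card_ord leqNgt subn1 ltn_predL (ltnW hm).
  by case: (ltngtP i j) neq_ij => [? _|? _|/val_inj-> /eqP//];
    [exists i, j | exists j, i].
have neq_a : a i != a j by rewrite neq_ltn a_incr.
have := satisfactory_same_color_quotient _ _ _ _ satc (a0 i) (a0 j) neq_a cij.
rewrite subn1 (ltn_predK hm).
by case/orP=> big; apply: leq_trans big (quot_le _ _).
Qed.
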